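(* Let $n\ge1$, $\sigma>0$, $\alpha\in(0,1)$, and $\boldsymbol\mu\in\mathcal S_n^\cup$. Observe $\mathbf y=\boldsymbol\mu+\boldsymbol\xi$ with $\boldsymbol\xi\sim\mathcal N(\mathbf 0,\sigma^2I_{n\times n})$. Let $\hat{\boldsymbol\mu}=\Pi_{\mathcal S_n^\cup}(\mathbf y)$ be the least squares estimator over $\mathcal S_n^\cup$, $\hat q=q(\hat{\boldsymbol\mu})$, and $$\hat r_\cup=\frac{\sigma^2\hat q\,\big(20+40\log n+10\log(1/\alpha)\big)}{n}.$$ Then with probability at least $1-\alpha$, $$\frac1n\sum_{i=1}^n(\hat\mu_i-\mu_i)^2\le\hat r_\cup .$$
   Context: For $n\ge3$, $\mathcal S_n^\cup=\{\mathbf u\in\mathbb R^n: 2u_i\le u_{i+1}+u_{i-1},\ i=2,\dots,n-1\}$ (convex sequences); $\mathcal S_1^\cup=\mathbb R$, $\mathcal S_2^\cup=\mathbb R^2$. $\Pi_{\mathcal S_n^\cup}$ is the Euclidean projection onto $\mathcal S_n^\cup$. For $\mathbf u\in\mathcal S_n^\cup$, $q(\mathbf u)-1$ is the number of strict inequalities among $2u_i\le u_{i+1}+u_{i-1}$, $i=2,\dots,n-1$; equivalently $q(\mathbf u)$ is the smallest number of affine pieces of $\mathbf u$. *)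

(* Defs.v *)
From HB Require Import structures.
From mathcomp Require Import all_boot all_order all_algebra.
From mathcomp Require Import all_classical all_reals all_analysis.
Set Implicit Arguments. Unset Strict Implicit. Unset Printing Implicit Defensive.
Import Order.TTheory GRing.Theory Num.Theory.
Local Open Scope classical_set_scope.
Local Open Scope ring_scope.

Section Defs.
Variable R : realType.

(* Convex sequences S_n^cup: 2 u_j <= u_i + u_k for consecutive i, j, k
   (vacuous when n <= 2, so S_1 = R, S_2 = R^2). *)
Definition convex_seq (n : nat) (u : 'I_n -> R) : Prop :=
  forall i j k : 'I_n, val j = (val i).+1 -> val k = (val j).+1 ->
    2 * u j <= u i + u k.

Definition qpieces (n : nat) (u : 'I_n -> R) : nat :=
  (#|[set j : 'I_n | [exists i : 'I_n, exists k : 'I_n,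
        [&& val j == (val i).+1, val k == (val j).+1 & 2 * u j < u i + u k]]]|).+1.

Definition sqdist (n : nat) (u v : 'I_n -> R) : R :=
  \sum_(i < n) (u i - v i) ^+ 2.

Definition is_proj_convex (n : nat) (y u : 'I_n -> R) : Prop :=
  convex_seq u /\ forall v, convex_seq v -> sqdist y u <= sqdist y v.

(* Pi_{S_n^cup}(y) (the minimizer exists and is unique: closed convex set) *)
Definition proj_convex (n : nat) (y : 'I_n -> R) : 'I_n -> R :=
  xget (fun=> 0) (is_proj_convex y).

Definition rhat_cup (n : nat) (sigma alpha : R) (u : 'I_n -> R) : R :=
  sigma ^+ 2 * (qpieces u)%:R * (20 + 40 * ln (n%:R) + 10 * ln (alpha^-1)) / n%:R.

End Defs.

(* Main.v *)
(** The variational inequality for the projection gives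
    [|muhat - mu|^2 <= <xi, muhat - mu>].  The estimator is affine on [q] consecutive
    intervals [T], and [mu] is fixed, so on each [T] the difference [muhat - mu] lies in
    the space spanned by [1], [i] and [mu] on [T], of dimension at most 3 and independent
    of the noise.  Take an orthonormal family spanning that space for each of the at most
    [n^2] intervals: with probability at least [1 - alpha] the noise has squared inner
    product at most [sigma^2 L / 3] with all these vectors, where
    [L = 20 + 40 ln n + 10 ln (1/alpha)], by Chernoff's bound and
    [6 n^2 exp (- L / 6) <= alpha].  On this event the contribution [S] of a piece to
    [<xi, muhat - mu>] satisfies [S^2 <= sigma^2 L |muhat - mu|_T^2], hence
    [2 S <= sigma^2 L + |muhat - mu|_T^2]; summing over the pieces gives
    [|muhat - mu|^2 <= q sigma^2 L]. *)

Require Import Defs.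
From HB Require Import structures.
From mathcomp Require Import all_boot all_order all_algebra.
From mathcomp Require Import all_classical all_reals all_analysis.
From mathcomp Require Import measurable_realfun ring lra zify.
Set Implicit Arguments.
Unset Strict Implicit.
Unset Printing Implicit Defensive.
Import Order.TTheory GRing.Theory Num.Theory.
Import numFieldNormedType.Exports.
Local Open Scope classical_set_scope.
Local Open Scope ring_scope.

(** * Weighted laws: integrals determined by their values on indicators *)

Section weighted_law.
Local Open Scope ereal_scope.
Import HBNNSimple.

(** Monotone convergence along the simple approximations of [f]. On the right, [m], [Z] and [G]
    enter only through integrals of [G] against indicators of events of [Z]. *)
Lemma integral_weighted_approx (R : realType) (d d' : measure_display)
  (T : measurableType d) (S : measurableType d')
  (m : {measure set T -> \bar R}) (Z : T -> S) (G : T -> R) (f : S -> R)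
  (mf : measurable_fun setT (fun x => (f x)%:E)) :
  measurable_fun setT Z -> measurable_fun setT G -> (forall x, 0 <= G x)%R ->
  (forall x, 0 <= f x)%R ->
  let h := nnsfun_approx measurableT mf in
  \int[m]_x (G x * f (Z x))%:E =
  limn (fun k => \sum_(y \in range (h k))
    y%:E * \int[m]_x (G x * \1_(h k @^-1` [set y]) (Z x))%:E).
Proof.
move=> mZ mG G0 f0 h.
have mhZ k : measurable_fun setT (fun x => h k (Z x)).
  exact: (@measurableT_comp _ _ _ _ _ _ (h k)).
transitivity (limn (fun k => \int[m]_x (G x * h k (Z x))%:E)).
  rewrite -monotone_convergence//=.
  - apply: eq_integral => x _; apply/esym/cvg_lim => //=.
    under eq_fun do rewrite EFinM.
    rewrite EFinM; apply: cvgeZl => //.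
    by apply: (@cvg_nnsfun_approx _ _ _ _ measurableT _ mf) => // y _; rewrite lee_fin.
  - by move=> k; apply/measurable_EFinP/measurable_funM.
  - by move=> k x _; rewrite lee_fin mulr_ge0.
  - move=> x _ a b ab; rewrite lee_fin ler_wpM2l//.
    exact/lefP/nd_nnsfun_approx.
congr (limn _); apply/funext => k.
have mI y : measurable_fun setT (fun x => \1_(h k @^-1` [set y]) (Z x) : R).
  exact: (@measurableT_comp _ _ _ _ _ _ (\1_(h k @^-1` [set y]) : S -> R)).
under eq_integral.
  move=> x _; rewrite EFinM fimfunE -fsumEFin// ge0_mule_fsumr; last first.
    by move=> r; rewrite EFinM nnfun_muleindic_ge0.
  over.
rewrite ge0_integral_fsum//; last 2 first.
- move=> y; apply: emeasurable_funM; apply/measurable_EFinP => //.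
  exact: measurable_funM.
- by move=> y x _; rewrite mule_ge0 ?lee_fin// -lee_fin EFinM nnfun_muleindic_ge0.
apply: eq_fsbigr => y /[!inE] -[z _ zy].
rewrite -ge0_integralZl_EFin//.
- by apply: eq_integral => x _; rewrite -!EFinM; congr EFin; rewrite mulrCA.
- by move=> x _; rewrite lee_fin mulr_ge0// ?indicE.
- exact/measurable_EFinP/measurable_funM.
- by rewrite -zy.
Qed.

(** Both sides are limits of the same expression in the integrals of indicators. It serves twice: to
    pass from a law to its density, and to exchange an indicator for a general function under
    independence. *)
Lemma eq_integral_weighted (R : realType) (d1 d2 d : measure_display)
  (T1 : measurableType d1) (T2 : measurableType d2) (S : measurableType d)
  (m1 : {measure set T1 -> \bar R}) (m2 : {measure set T2 -> \bar R})
  (Z1 : T1 -> S) (Z2 : T2 -> S) (G1 : T1 -> R) (G2 : T2 -> R) (f : S -> R) :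
  measurable_fun setT Z1 -> measurable_fun setT Z2 ->
  measurable_fun setT G1 -> measurable_fun setT G2 ->
  (forall x, 0 <= G1 x)%R -> (forall x, 0 <= G2 x)%R ->
  (forall A, measurable A ->
    \int[m1]_x (G1 x * \1_A (Z1 x))%:E = \int[m2]_x (G2 x * \1_A (Z2 x))%:E) ->
  measurable_fun setT f -> (forall x, 0 <= f x)%R ->
  \int[m1]_x (G1 x * f (Z1 x))%:E = \int[m2]_x (G2 x * f (Z2 x))%:E.
Proof.
move=> mZ1 mZ2 mG1 mG2 G10 G20 E /measurable_EFinP mf f0.
rewrite !(@integral_weighted_approx _ _ _ _ _ _ _ _ _ mf)//.
congr (limn _); apply/funext => k; apply: eq_fsbigr => y _; congr (_ * _).
by apply: E; exact: measurable_funPTI.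
Qed.

End weighted_law.

(** * The moment generating function of a normal variable *)

Section normal_law.
Local Open Scope ereal_scope.

Lemma integral_indic_preimage (R : realType) (d : measure_display)
  (T : measurableType d) (P : probability T R) (X : {RV P >-> R}) (A : set R) :
  measurable A -> \int[P]_w (\1_A (X w))%:E = P (X @^-1` A).
Proof.
move=> mA; rewrite -[X @^-1` A]setIT -integral_indic//.
exact: measurable_funPTI.
Qed.

(** Completing the square in the exponent. *)
Lemma normal_pdf_shift (R : realType) (s t x : R) : (0 < s)%R ->
  (normal_pdf 0 s x * expR (t * x) =
   expR (s ^+ 2 * t ^+ 2 / 2) * normal_pdf (s ^+ 2 * t) s x)%R.
Proof.
move=> s0; rewrite !normal_pdfE ?gt_eqF//= -[LHS]mulrA [RHS]mulrCA /normal_fun -!expRD.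
by congr (_ * expR _)%R; field; exact: lt0r_neq0.
Qed.

Lemma integral_expR_normal (R : realType) (d : measure_display)
  (T : measurableType d) (P : probability T R) (X : {RV P >-> R}) (s t : R) :
  (0 < s)%R ->
  (forall A, measurable A -> distribution P X A = normal_prob 0 s A) ->
  \int[P]_w (expR (t * X w))%:E = (expR (s ^+ 2 * t ^+ 2 / 2))%:E.
Proof.
move=> s0 XN.
have me : measurable_fun setT (fun x : R => expR (t * x)).
  by apply: measurableT_comp => //; exact: measurable_funM.
transitivity (\int[P]_w (1 * expR (t * X w))%:E).
  by under [RHS]eq_integral do rewrite mul1r.
(* Weight 1 under [P] is matched with the normal density under Lebesgue measure; after the shift,
   what remains is the integral of a density, which is 1. *)
rewrite (@eq_integral_weighted _ _ _ _ _ _ _ P lebesgue_measure X id (cst 1%R)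
  (normal_pdf 0 s) (fun x : R => expR (t * x)))//=.
- under eq_integral do rewrite normal_pdf_shift// EFinM.
  rewrite ge0_integralZl_EFin ?expR_ge0//.
  + by rewrite integral_normal_pdf mule1.
  + by move=> x _; rewrite lee_fin normal_pdf_ge0.
  + apply/(@measurable_EFinP _ _ R); exact: measurable_normal_pdf.
- exact: measurable_normal_pdf.
- by move=> x; exact: normal_pdf_ge0.
- move=> A mA; under eq_integral do rewrite mul1r.
  rewrite integral_indic_preimage// -[LHS]/(distribution P X A) XN//.
  rewrite /normal_prob integral_mkcond.
  apply: eq_integral => x _; rewrite patchE indicE.
  by case: ifPn => xA; rewrite ?(mulr1,mulr0).
Qed.

End normal_law.

(** * Expectation of a product of independent factors *)

Section independence.
Local Open Scope ereal_scope.

Lemma integral_prod_indep (R : realType) (d : measure_display)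
  (T : measurableType d) (P : probability T R) (n : nat)
  (X : 'I_n -> {RV P >-> R}) (f : 'I_n -> R -> R) :
  (forall A : 'I_n -> set R, (forall i, measurable (A i)) ->
     fine (P [set w | forall i, A i (X i w)]) =
     (\prod_(i < n) fine (P (X i @^-1` A i)))%R) ->
  (forall i, measurable_fun setT (f i)) -> (forall i x, 0 <= f i x)%R ->
  (forall i, \int[P]_w (f i (X i w))%:E \is a fin_num) ->
  \int[P]_w (\prod_(i < n) f i (X i w))%:E =
  (\prod_(i < n) fine (\int[P]_w (f i (X i w))%:E))%:E.
Proof.
move=> ind mf f0 ffin.
(* Replace the indicators of the product rule by the [f i], one coordinate at a time. *)
pose g (k : nat) (A : 'I_n -> set R) (i : 'I_n) : R -> R :=
  if (i < k)%N then f i else \1_(A i).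
suff H : forall k A, (forall i, measurable (A i)) ->
    \int[P]_w (\prod_(i < n) g k A i (X i w))%:E =
    (\prod_(i < n) fine (\int[P]_w (g k A i (X i w))%:E))%:E.
  have := H n (fun=> setT) (fun=> measurableT); rewrite /g.
  under eq_integral do under eq_bigr do rewrite ltn_ord.
  by under [in X in _ = X -> _]eq_bigr do rewrite ltn_ord.
have mg k A i : (forall i, measurable (A i)) -> measurable_fun setT (g k A i).
  by rewrite /g; case: ifP.
have g0 k A i x : (0 <= g k A i x)%R by rewrite /g; case: ifP => // _; rewrite indicE.
have mgX k A i : (forall i, measurable (A i)) ->
    measurable_fun setT (fun w => g k A i (X i w)).
  by move=> mA; apply: measurableT_comp => //; exact: mg.
elim=> [|k IH] A mA.
  have mI : measurable [set w | forall i, A i (X i w)].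
    rewrite (_ : [set w | _] = \bigcap_(i in [set: 'I_n]) (X i @^-1` A i)); last first.
      by apply/seteqP; split => [w Aw i _|w Aw i]; [exact: Aw|exact: (Aw i)].
    apply: fin_bigcap_measurable => [|i _]; first exact: finite_finset.
    exact: measurable_funPTI.
  transitivity (P [set w | forall i, A i (X i w)]).
    rewrite -[X in P X]setIT -integral_indic//.
    apply: eq_integral => w _; congr EFin; rewrite indicE.
    have [/set_mem Aw|nA] := boolP (w \in _).
      by rewrite big1// => i _; rewrite /g/= indicE mem_set.
    have [i /negP Ai] : exists i, ~~ (X i w \in A i).
      apply: contrapT => /forallNP h; move/negP: nA; apply; apply/mem_set => i.
      by have /negP := h i; rewrite negbK => /set_mem.
    by rewrite (bigD1 i)//= /g/= indicE (negbTE (introN idP Ai)) mul0r.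
  rewrite -[LHS]fineK ?fin_num_measure//.
  rewrite ind//; congr EFin; apply: eq_bigr => i _.
  by rewrite integral_indic_preimage.
(* Past [n] every factor is already an [f i], so the step changes nothing. *)
have [nk|kn] := leqP n k.
  have E i : g k.+1 A i = g k A i by rewrite /g !(leq_trans (ltn_ord i))// leqW.
  under eq_integral do under eq_bigr do rewrite E.
  by under [in RHS]eq_bigr do rewrite E; exact: IH.
pose j := Ordinal kn.
have gE i : i != j -> g k.+1 A i = g k A i.
  move=> ij; rewrite /g ltnS leq_eqVlt; case: eqP => //= ik.
  by move: ij; rewrite -(inj_eq val_inj) /= ik eqxx.
under eq_integral.
  move=> w _; rewrite (bigD1 j)//= mulrC.
  under eq_bigr do rewrite gE//.
  over.
(* Only factor [j] changes at this step. The other factors act as a weight [G] on the law of [X j],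
   to be compared with the constant weight [c], the product of their expectations. *)
pose G w := (\prod_(i < n | i != j) g k A i (X i w))%R.
pose c := (\prod_(i < n | i != j) fine (\int[P]_w (g k A i (X i w))%:E))%R.
have c0 : (0 <= c)%R.
  apply: prodr_ge0 => i _; apply: fine_ge0; apply: integral_ge0 => w _.
  by rewrite lee_fin.
have intc (h : R -> R) : measurable_fun setT h -> (forall x, 0 <= h x)%R ->
    \int[P]_w (c * h (X j w))%:E = c%:E * \int[P]_w (h (X j w))%:E.
  move=> mh h0; under eq_integral do rewrite EFinM.
  rewrite ge0_integralZl_EFin// => [w _|]; first by rewrite lee_fin.
  by apply/measurable_EFinP; apply: measurableT_comp.
have gj : g k.+1 A j = f j by rewrite /g /= ltnSn.
rewrite gj (bigD1 j)//= gj.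
rewrite (eq_bigr (fun i => fine (\int[P]_w (g k A i (X i w))%:E))); last first.
  by move=> i ij; rewrite gE.
rewrite -/c (eq_integral (fun w => (G w * f j (X j w))%:E))//.
rewrite (@eq_integral_weighted _ _ _ _ _ _ _ P P (X j) (X j) G (cst c) (f j))//=.
- by rewrite intc// EFinM fineK// muleC.
- rewrite /G; under eq_fun do rewrite -big_filter.
  by apply: measurable_prod => i _; exact: mgX.
- by move=> w; apply: prodr_ge0.
move=> B mB.
(* At stage [k] factor [j] is still an indicator of an arbitrary set, so the induction hypothesis
   with [B] in position [j] is the required identity on indicators. *)
pose A' i := if i == j then B else A i.
have mA' i : measurable (A' i) by rewrite /A'; case: ifP.
have gB : g k A' j = \1_B by rewrite /g /A' ltnn eqxx.
have gA i : i != j -> g k A' i = g k A i by move=> /negbTE ij; rewrite /g /A' ij.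
rewrite intc//.
transitivity (\int[P]_w (\prod_(i < n) g k A' i (X i w))%:E).
  apply: eq_integral => w _; rewrite (bigD1 j)//= gB mulrC; congr (_ * _)%:E.
  by apply: eq_bigr => i ij; rewrite gA.
rewrite IH// (bigD1 j)//= gB EFinM muleC; congr (_ * _).
  by congr EFin; apply: eq_bigr => i ij; rewrite gA.
by rewrite fineK// integral_indic_preimage// fin_num_measure//; exact: measurable_funPTI.
Qed.

End independence.

(** * Existence of the projection and its variational inequality *)

Section projection.
Context {R : realType}.
Implicit Types n : nat.

(** A continuous function attains its minimum on a compact set: [K] keeps the convex sequences at
    least as close to [y] as the zero sequence, and is closed, bounded and nonempty. *)
Lemma is_proj_convex_exists {n} (y : 'I_n -> R) : exists u, is_proj_convex y u.
Proof.
pose K : set 'rV[R]_n := [set v | convex_seq (fun i => v ord0 i) /\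
  sqdist y (fun i => v ord0 i) <= sqdist y (fun=> 0)].
pose f (v : 'rV[R]_n) : R := sqdist y (fun i => v ord0 i).
have cf : continuous f.
  apply: continuous_big => [|i _ v]; first exact: add_continuous.
  apply: (@continuous_comp _ _ _ (fun v : 'rV[R]_n => y i - v ord0 i) (fun x => x ^+ 2));
    last exact: exprn_continuous.
  apply: (@continuousB _ R^o _ (fun=> y i)); first exact: cst_continuous.
  exact: coord_continuous.
have K0 : K !=set0.
  exists 0; split; last by under [X in sqdist _ X]eq_fun do rewrite mxE.
  by move=> i j k _ _; rewrite !mxE mulr0 addr0.
have cK : closed K.
  rewrite (_ : K = \bigcap_(t in [set t : 'I_n * 'I_n * 'I_n |
      val t.1.2 = (val t.1.1).+1 /\ val t.2 = (val t.1.2).+1])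
      [set v : 'rV[R]_n | 2 * v ord0 t.1.2 <= v ord0 t.1.1 + v ord0 t.2]
    `&` f @^-1` [set x | x <= sqdist y (fun=> 0)]); last first.
    apply/seteqP; split => v [cv fv]; split => //.
      by move=> [[i j] k]/= [ij jk]; exact: cv.
    by move=> i j k ij jk; exact: (cv (i, j, k)).
  apply: closedI; last first.
    by apply: preimage_closed; [move=> v _; exact: cf|exact: closed_le].
  apply: closed_bigI => -[[i j] k] _ /=.
  rewrite (_ : [set v | _] =
    (fun v : 'rV[R]_n => 2 * v ord0 j - (v ord0 i + v ord0 k)) @^-1` [set x | x <= 0]).
    apply: preimage_closed; last exact: closed_le.
    move=> v _; apply: (@continuousB _ R^o _ (fun v : 'rV[R]_n => 2 * v ord0 j)
      (fun v : 'rV[R]_n => v ord0 i + v ord0 k)).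
      by apply: continuousM; [exact: cst_continuous|exact: coord_continuous].
    apply: (@continuousD _ R^o _ (fun v : 'rV[R]_n => v ord0 i)
      (fun v : 'rV[R]_n => v ord0 k));
      exact: coord_continuous.
  by apply/seteqP; split => v /=; rewrite subr_le0.
have bK : bounded_set K.
  (* The bound comes from [|v| <= |y| + |y - v|] in each coordinate, together with
     [|z| <= z^2 + 1]. *)
  pose M := \sum_(i < n) `|y i| + sqdist y (fun=> 0) + 1.
  have q0 : 0 <= sqdist y (fun=> 0) by apply: sumr_ge0 => i _; exact: sqr_ge0.
  have s0 : 0 <= \sum_(i < n) `|y i| by apply: sumr_ge0.
  exists M; split => [|x Mx v [_ fv]]; first exact: num_real.
  apply: le_trans (ltW Mx).
  rewrite [leLHS]/Num.norm /= mx_normrE; apply/bigmax_leP; split => [|[a i] _ /=].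
    by rewrite /M; lra.
  rewrite (ord1 a).
  have yi : `|y i| <= \sum_(i < n) `|y i|.
    by rewrite (bigD1 i)//= lerDl; apply: sumr_ge0.
  have vi : (y i - v ord0 i) ^+ 2 <= sqdist y (fun=> 0).
    apply: le_trans fv; rewrite /sqdist (bigD1 i)//= lerDl.
    by apply: sumr_ge0 => j _; exact: sqr_ge0.
  have := ler_normB (y i) (y i - v ord0 i).
  rewrite opprB addrCA subrr addr0 => /le_trans; apply.
  rewrite /M -addrA; apply: lerD => //.
  have := sqr_ge0 (`|y i - v ord0 i| - 1); rewrite -real_normK ?num_real// in vi.
  nra.
have [u /set_mem [cu fu] umin] := EVT_min_rV K0 (bounded_closed_compact bK cK)
  (continuous_subspaceT cf).
exists (fun i => u ord0 i); split => // v cv.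
pose v' : 'rV[R]_n := \row_i v i.
have v'E : (fun i => v' ord0 i) = v by apply/funext => i; rewrite mxE.
(* A competitor outside [K] is farther from [y] than the zero sequence, hence than the minimizer. *)
have [fv|/ltW fv] := leP (sqdist y v) (sqdist y (fun=> 0)); last exact: le_trans fv.
by have := umin v'; rewrite /f v'E; apply; rewrite inE /K/= v'E.
Qed.

Lemma proj_convexP {n} (y : 'I_n -> R) : is_proj_convex y (proj_convex y).
Proof.
rewrite /proj_convex; case: xgetP => [u _ //|].
by have [u yu] := is_proj_convex_exists y => /(_ u).
Qed.

(** The segment from [u] to [mu] stays among convex sequences. Comparing [u] with its point at
    parameter [t] gives [2 (D - c) <= t D], which for small [t] forces [D <= c]. *)
Lemma is_proj_convex_sqdist_le {n} (mu xi u : 'I_n -> R) :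
  convex_seq mu -> is_proj_convex (fun i => mu i + xi i) u ->
  sqdist u mu <= \sum_(i < n) xi i * (u i - mu i).
Proof.
move=> cmu [cu umin].
pose D := sqdist u mu; pose c := \sum_(i < n) xi i * (u i - mu i).
have D0 : 0 <= D by apply: sumr_ge0 => i _; exact: sqr_ge0.
have key t : 0 < t -> t <= 1 -> 2 * (D - c) <= t * D.
  move=> t0 t1.
  have := umin (fun i => u i + t * (mu i - u i)).
  have cv : convex_seq (fun i => u i + t * (mu i - u i)).
    by move=> i j k ij jk; have := cu i j k ij jk; have := cmu i j k ij jk; nra.
  move=> /(_ cv).
  have -> : sqdist (fun i => mu i + xi i) (fun i => u i + t * (mu i - u i)) =
     sqdist (fun i => mu i + xi i) u - 2 * t * (D - c) + t ^+ 2 * D.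
    rewrite /D /c /sqdist -sumrB mulr_sumr -sumrB mulr_sumr -big_split /=.
    by apply: eq_bigr => i _; ring.
  rewrite -subr_ge0 => h.
  rewrite -(ler_pM2l t0); nra.
rewrite leNgt; apply/negP => cD.
have {}cD : 0 < D - c by rewrite subr_gt0.
(* This makes [t (D + 1) <= D - c], contradicting [key]; the denominator is [D + 1] because [D] may
   vanish. *)
pose t := Num.min 1 ((D - c) / (D + 1)).
have t0 : 0 < t by rewrite lt_min ltr01 divr_gt0//; lra.
have t1 : t <= 1 by rewrite ge_min lexx.
have tD : t * (D + 1) <= D - c.
  by rewrite -ler_pdivlMr; [rewrite ge_min lexx orbT|lra].
have := key t t0 t1; nra.
Qed.

End projection.

(** * Gram-Schmidt for possibly dependent families, and inner products with their span *)

Section gram_schmidt.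
Context {R : realType} {n : nat}.
Implicit Types u v e : 'I_n -> R.

Definition dotf u v : R := \sum_(i < n) u i * v i.

Lemma dotfDl u v w : dotf (fun i => u i + v i) w = dotf u w + dotf v w.
Proof. by rewrite /dotf -big_split; apply: eq_bigr => i _; rewrite mulrDl. Qed.

Lemma dotfZl a u v : dotf (fun i => a * u i) v = a * dotf u v.
Proof. by rewrite /dotf mulr_sumr; apply: eq_bigr => i _; rewrite mulrA. Qed.

Lemma dotfC u v : dotf u v = dotf v u.
Proof. by apply: eq_bigr => i _; rewrite mulrC. Qed.

Lemma dotf_ge0 u : 0 <= dotf u u.
Proof. by apply: sumr_ge0 => i _; rewrite -expr2 sqr_ge0. Qed.

Lemma dotf_eq0 u : dotf u u = 0 -> u = fun=> 0.
Proof.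
move=> /eqP; rewrite psumr_eq0 => [/allP u0|i _]; last by rewrite -expr2 sqr_ge0.
apply/funext => i; have := u0 i (mem_index_enum i).
by rewrite /= mulf_eq0 orbb => /eqP.
Qed.

Lemma dotf_sumr {k} (a : 'I_k -> R) (f : 'I_k -> 'I_n -> R) u :
  dotf u (fun i => \sum_(j < k) a j * f j i) = \sum_(j < k) a j * dotf u (f j).
Proof.
rewrite /dotf; under [LHS]eq_bigr do rewrite mulr_sumr.
rewrite exchange_big /=; apply: eq_bigr => j _; rewrite mulr_sumr.
by apply: eq_bigr => i _; rewrite mulrCA.
Qed.

(** For nonzero [v], expand the squared norm of [<v,v> u - <u,v> v]. *)
Lemma dotf_CS u v : dotf u v ^+ 2 <= dotf u u * dotf v v.
Proof.
have [v0|v0] := eqVneq (dotf v v) 0.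
  rewrite v0 mulr0 /dotf big1 ?expr0n// => i _.
  by rewrite (dotf_eq0 v0) mulr0.
have vp : 0 < dotf v v by rewrite lt_def v0 dotf_ge0.
rewrite -subr_ge0 -(pmulr_rge0 _ vp).
have := dotf_ge0 (fun i => dotf v v * u i + (- dotf u v) * v i).
rewrite dotfDl !dotfZl (dotfC u) (dotfC v) !dotfDl !dotfZl (dotfC v u).
by congr (0 <= _); ring.
Qed.

(** Allowing zero vectors lets Gram-Schmidt keep its indexing when a vector depends on the preceding
    ones. *)
Definition zero_or_unit e := dotf e e = 1 \/ e = fun=> 0.

Lemma zero_or_unit_le1 e : zero_or_unit e -> dotf e e <= 1.
Proof. by move=> [->//|->]; rewrite /dotf big1// => i _; rewrite mul0r. Qed.

Lemma dotf_zero_or_unit u e : zero_or_unit e -> dotf u e * dotf e e = dotf u e.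
Proof.
move=> [->|->]; first by rewrite mulr1.
by rewrite /dotf big1 ?mul0r// => i _; rewrite mulr0.
Qed.

(** Both scalings are recorded: the first expands [v] in [e], the second carries orthogonality from
    [v] to [e]. *)
Lemma normalize_exists v :
  exists e, zero_or_unit e /\ exists r s, v = (fun i => r * e i) /\ e = (fun i => s * v i).
Proof.
have [v0|v0] := eqVneq (dotf v v) 0.
  exists (fun=> 0); split; first by right.
  by exists 0, 0; split; [rewrite (dotf_eq0 v0)|]; apply/funext => i; rewrite mul0r.
have vp : 0 < dotf v v by rewrite lt_def v0 dotf_ge0.
pose r := Num.sqrt (dotf v v).
have r0 : r != 0 by rewrite sqrtr_eq0 -ltNge.
have r2 : r ^+ 2 = dotf v v by rewrite sqr_sqrtr// dotf_ge0.
exists (fun i => r^-1 * v i); split.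
  by left; rewrite dotfZl dotfC dotfZl -r2; field.
exists r, r^-1; split => //.
by apply/funext => i; rewrite mulrA divff// mul1r.
Qed.

Lemma gram_schmidt k (v : nat -> 'I_n -> R) :
  exists (e : nat -> 'I_n -> R) (B : nat -> nat -> R),
  [/\ forall i, zero_or_unit (e i),
      forall i j, (i < j < k)%N -> dotf (e i) (e j) = 0 &
      forall j, (j < k)%N -> v j = fun x => \sum_(i < k) B j i * e i x].
Proof.
elim: k => [|k [e [B [eu eo vE]]]].
  exists (fun _ _ => 0), (fun _ _ => 0); split => //; first by right.
  by move=> i j; rewrite ltn0 andbF.
pose p x := \sum_(j < k) dotf (v k) (e j) * e j x.
pose w x := v k x + (-1) * p x.
have we l : (l < k)%N -> dotf (e l) w = 0.
  move=> lk; rewrite dotfC dotfDl dotfZl (dotfC p) dotf_sumr (bigD1 (Ordinal lk))//=.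
  rewrite big1 => [|j jl]; last first.
    have : (j != l :> nat) by move: jl; rewrite -(inj_eq val_inj).
    rewrite neq_ltn => /orP[jl'|lj]; last by rewrite eo ?mulr0// lj ltn_ord.
    by rewrite (dotfC (e l)) eo ?mulr0// jl' lk.
  by rewrite addr0 dotf_zero_or_unit//; ring.
have [f [fu [r [s [wf fw]]]]] := normalize_exists w.
exists (fun i => if i == k then f else e i).
exists (fun j i => if j == k then (if i == k then r else dotf (v k) (e i))
                   else if i == k then 0 else B j i).
have nk (i : 'I_k) : (i == k :> nat) = false.
  by apply/eqP => ik; have := ltn_ord i; rewrite ik ltnn.
split => [i|i j /andP[ij]|j].
- by case: ifP.
- rewrite ltnS leq_eqVlt; case: (eqVneq j k) ij => [-> ik _|jk ij /= jk'].
    by rewrite (ltn_eqF ik) fw dotfC dotfZl dotfC we ?mulr0.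
  by rewrite (ltn_eqF (ltn_trans ij jk')) eo ?ij.
- rewrite ltnS leq_eqVlt; case: (eqVneq j k) => [-> _|jk /= jk'].
    apply/funext => x; rewrite big_ord_recr /= eqxx.
    under eq_bigr do rewrite nk.
    have := congr1 (fun h => h x) wf; rewrite /w -/(p x) => <-; ring.
  rewrite (vE _ jk'); apply/funext => x; rewrite big_ord_recr /= eqxx mul0r addr0.
  by apply: eq_bigr => i _; rewrite nk.
Qed.

End gram_schmidt.

(** Parseval for [h] in the Gram-Schmidt family of [v], then Cauchy-Schwarz on the [k] coordinates.
    The family is chosen before [c], [x] and [h], so it can stay fixed while the noise varies. *)
Lemma span_frame (R : realType) n k (v : nat -> 'I_n -> R) :
  exists e : nat -> 'I_n -> R, (forall j, dotf (e j) (e j) <= 1) /\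
    forall (c : nat -> R) (x h : 'I_n -> R),
    h = (fun i => \sum_(j < k) c j * v j i) ->
    dotf x h ^+ 2 <= dotf h h * \sum_(j < k) dotf x (e j) ^+ 2.
Proof.
have [e [B [eu eo vE]]] := gram_schmidt k v.
exists e; split => [j|c x h hv]; first exact: zero_or_unit_le1.
pose b (i : nat) := \sum_(j < k) c j * B j i.
have hE : h = fun y => \sum_(i < k) b i * e i y.
  rewrite hv; apply/funext => y; rewrite /b; under [RHS]eq_bigr do rewrite mulr_suml.
  rewrite exchange_big /=; apply: eq_bigr => j _.
  rewrite (vE j)// mulr_sumr; apply: eq_bigr => i _; exact: mulrA.
have he (l : 'I_k) : dotf h (e l) = b l * dotf (e l) (e l).
  rewrite dotfC hE dotf_sumr (bigD1 l)//= big1 ?addr0// => j jl.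
  have : (j != l :> nat) by [].
  rewrite neq_ltn => /orP[jl'|lj]; last by rewrite eo ?mulr0// lj ltn_ord.
  by rewrite (dotfC (e l)) eo ?mulr0// jl' ltn_ord.
have -> : dotf h h = \sum_(j < k) dotf h (e j) ^+ 2.
  rewrite {2}hE dotf_sumr; apply: eq_bigr => j _.
  by rewrite he expr2 mulrACA dotf_zero_or_unit// mulrA.
have -> : dotf x h = \sum_(j < k) dotf h (e j) * dotf x (e j).
  rewrite hE dotf_sumr -hE; apply: eq_bigr => j _.
  by rewrite he -mulrA; congr (_ * _); rewrite mulrC dotf_zero_or_unit.
have := dotf_CS (fun j : 'I_k => dotf h (e j)) (fun j : 'I_k => dotf x (e j)).
rewrite {1}/dotf => /le_trans; apply.
by rewrite le_eqVlt; apply/orP; left; apply/eqP; congr (_ * _); apply: eq_bigr.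
Qed.

(** * Affine pieces of a convex sequence and the deterministic risk bound *)

Section pieces.
Context {R : realType}.

Lemma affine_of_eq_increments (U : nat -> R) (s e : nat) :
  (forall k, (s <= k)%N -> (k.+2 <= e)%N -> U k.+2 - U k.+1 = U k.+1 - U k) ->
  forall i, (s <= i <= e)%N ->
  U i = U s - (U s.+1 - U s) * s%:R + (U s.+1 - U s) * i%:R.
Proof.
move=> HU.
have slope m : ((s + m).+1 <= e)%N -> U (s + m).+1 - U (s + m)%N = U s.+1 - U s.
  elim: m => [|m IH] me; first by rewrite addn0.
  rewrite -IH ?addnS; last by rewrite -addnS ltnW.
  by apply: HU; [exact: leq_addr|rewrite -addnS].
have main m : (s + m <= e)%N -> U (s + m)%N = U s + (U s.+1 - U s) * m%:R.
  elim: m => [|m IH] me; first by rewrite addn0 mulr0 addr0.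
  have me' : ((s + m).+1 <= e)%N by rewrite -addnS.
  have := slope _ me'; rewrite IH ?(ltnW me')// addnS -[in m.+1%:R]addn1 natrD.
  by move=> /eqP; rewrite subr_eq => /eqP ->; ring.
move=> i /andP[si ie].
by rewrite -{1}(subnKC si) main ?subnKC// natrB//; ring.
Qed.

Definition knot n (u : 'I_n -> R) (j : 'I_n) : bool :=
  [exists i : 'I_n, exists k : 'I_n,
     [&& val j == (val i).+1, val k == (val j).+1 & 2 * u j < u i + u k]].

Lemma qpiecesE n (u : 'I_n -> R) : qpieces u = #|knot u|.+1.
Proof.
congr _.+1; apply: eq_card => j.
by apply/idP/idP => [/set_mem//|h]; apply/mem_set.
Qed.

(** The label of the piece containing [i]: it is nondecreasing in [i], so its level sets are
    intervals. *)
Definition knots_before n (u : 'I_n -> R) (i : nat) : nat :=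
  #|[pred j : 'I_n | knot u j && (j < i)%N]|.

Lemma knots_before_le n (u : 'I_n -> R) :
  {homo knots_before u : i i' / (i <= i')%N}.
Proof.
move=> i i' ii'; apply: subset_leq_card; apply/fintype.subsetP => j.
by rewrite !inE => /andP[-> /leq_trans]; exact.
Qed.

Lemma knots_before_lt n (u : 'I_n -> R) i : (knots_before u i < qpieces u)%N.
Proof.
rewrite qpiecesE ltnS; apply: subset_leq_card; apply/fintype.subsetP => j.
by rewrite inE => /andP[].
Qed.

(* A knot is put in the piece on its left. *)
Lemma convex_pieces n (u : 'I_n -> R) : convex_seq u ->
  exists c : 'I_n -> 'I_(qpieces u), forall i0, exists (s e : 'I_n) (a b : R),
    (forall i, (c i == c i0) = (s <= i <= e)%N) /\
    (forall i : 'I_n, (s <= i <= e)%N -> u i = a + b * (i : nat)%:R).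
Proof.
move=> cu; exists (fun i => Ordinal (knots_before_lt u i)) => i0.
pose N := knots_before u.
(* [s] and [e] are the first and last indices with the label of [i0]. *)
have [s sE smin] := @arg_minnP _ i0 (fun i => N i == N i0)
  (fun i : 'I_n => i : nat) (eqxx _).
have [e eE emax] := @arg_maxnP _ i0 (fun i => N i == N i0)
  (fun i : 'I_n => i : nat) (eqxx _).
(* The default 0 can enter only through [U s.+1] when [s] is the last index; the piece is then the
   single point [s], where the affine formula holds for any slope. *)
pose U k : R := if insub k is Some i then u i else 0.
have UE (i : 'I_n) : U i = u i by rewrite /U valK.
exists s, e, (U s - (U s.+1 - U s) * (s : nat)%:R), (U s.+1 - U s).
have lev (i : 'I_n) : (N i == N i0) = (s <= i <= e)%N.
  apply/idP/idP => [h|/andP[si ie]]; first apply/andP.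
    by split; [exact: smin|exact: emax].
  rewrite eqn_leq -{1}(eqP eE) -(eqP sE); apply/andP; split; exact: knots_before_le.
split => [i|i ise]; first by rewrite -lev -(inj_eq val_inj).
rewrite -UE; apply: affine_of_eq_increments ise => k sk ke.
have k2 : (k.+2 < n)%N by exact: leq_ltn_trans ke (ltn_ord e).
have k1 : (k.+1 < n)%N by exact: ltnW.
have k0 : (k < n)%N by exact: ltnW.
have := UE (Ordinal k0); have := UE (Ordinal k1); have := UE (Ordinal k2).
move=> /= -> -> ->.
have le2 := cu (Ordinal k0) (Ordinal k1) (Ordinal k2) erefl erefl.
suff : ~~ (2 * u (Ordinal k1) < u (Ordinal k0) + u (Ordinal k2)).
  by rewrite -leNgt => ge2; lra.
apply/negP => lt2.
have kn : knot u (Ordinal k1).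
  apply/existsP; exists (Ordinal k0); apply/existsP; exists (Ordinal k2).
  by rewrite /= !eqxx.
(* A knot at [k.+1] is counted before [k.+2] but not before [k.+1], although both indices carry the
   label of [i0]. *)
have : (N k.+1 < N k.+2)%N.
  apply: proper_card; apply/fintype.properP; split.
    by apply/fintype.subsetP => j; rewrite !inE => /andP[-> /ltnW].
  by exists (Ordinal k1); rewrite !inE kn ?ltnn//=.
have -> : N k.+1 = N i0.
  by apply/eqP; have := lev (Ordinal k1); rewrite /= => ->; lia.
have -> : N k.+2 = N i0.
  by apply/eqP; have := lev (Ordinal k2); rewrite /= => ->; lia.
by rewrite ltnn.
Qed.

Definition piece_gen n (mu : 'I_n -> R) (s e : 'I_n) (j : nat) (i : 'I_n) : R :=
  if (s <= i <= e)%N then nth 0 [:: 1; (i : nat)%:R; mu i] j else 0.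

(** The deterministic half of the argument: the noise enters only through the bound [t] on its
    squared inner products with the vectors [f s e j]. *)
Lemma sqdist_le_qpieces n (mu xi u : 'I_n -> R) (t : R)
  (f : 'I_n -> 'I_n -> nat -> 'I_n -> R) :
  0 <= t -> convex_seq mu -> is_proj_convex (fun i => mu i + xi i) u ->
  (forall s e (c : nat -> R) (x h : 'I_n -> R),
     h = (fun i => \sum_(j < 3) c j * piece_gen mu s e j i) ->
     dotf x h ^+ 2 <= dotf h h * \sum_(j < 3) dotf x (f s e j) ^+ 2) ->
  (forall s e (j : 'I_3), dotf xi (f s e j) ^+ 2 <= t) ->
  sqdist u mu <= (qpieces u)%:R * (3 * t).
Proof.
move=> t0 cmu pu fr good.
have := is_proj_convex_sqdist_le cmu pu.
have [c cP] := convex_pieces pu.1.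
rewrite (partition_big c xpredT)//=.
have piece p : \sum_(i < n | c i == p) xi i * (u i - mu i) <=
    (3 * t + \sum_(i < n | c i == p) (u i - mu i) ^+ 2) / 2.
  (* A label that no index carries contributes 0, which the nonnegative right side allows. *)
  have [/existsP[i0 /eqP <-]|/existsPn ne] := boolP [exists i, c i == p]; last first.
    rewrite !big_pred0 => [|i|i]; [|exact/negbTE..].
    by rewrite addr0 divr_ge0// mulr_ge0.
  have [s [e [a [b [lev aff]]]]] := cP i0.
  pose h (i : 'I_n) := if (s <= i <= e)%N then u i - mu i else 0.
  have xh : \sum_(i < n | c i == c i0) xi i * (u i - mu i) = dotf xi h.
    rewrite big_mkcond; apply: eq_bigr => i _; rewrite lev /h.
    by case: ifP; rewrite ?mulr0.
  have hh : \sum_(i < n | c i == c i0) (u i - mu i) ^+ 2 = dotf h h.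
    rewrite big_mkcond; apply: eq_bigr => i _; rewrite lev /h -expr2.
    by case: ifP; rewrite ?expr0n.
  rewrite xh hh.
  have /(fr s e (fun j => nth 0 [:: a; b; -1] j) xi) :
      h = fun i => \sum_(j < 3) nth 0 [:: a; b; -1] j * piece_gen mu s e j i.
    apply/funext => i; rewrite !big_ord_recl big_ord0 /= /piece_gen /h.
    by case: ifP => [/aff ->|_] /=; ring.
  have H0 := dotf_ge0 h.
  have : \sum_(j < 3) dotf xi (f s e j) ^+ 2 <= 3 * t.
    rewrite !big_ord_recl big_ord0.
    have := good s e ord0; have := good s e (lift ord0 ord0).
    have := good s e (lift ord0 (lift ord0 ord0)); lra.
  set Q := \sum_(j < 3) _; set S := dotf xi h; set H := dotf h h in H0 * => Qt SQ.
  rewrite ler_pdivlMr// leNgt; apply/negP => lt.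
  have : S ^+ 2 <= H * (3 * t) by apply: le_trans SQ _; rewrite ler_wpM2l.
  (* If [3 t + H < 2 S], then [(3 t + H)^2 < 4 S^2 <= 12 t H], against the nonnegative square. *)
  have := sqr_ge0 (3 * t - H); nra.
move=> /le_trans/(_ (ler_sum _ (fun p _ => piece p))).
rewrite -mulr_suml big_split /= sumr_const card_ord.
have <- : sqdist u mu = \sum_p \sum_(i < n | c i == p) (u i - mu i) ^+ 2.
  by rewrite /sqdist (partition_big c xpredT).
rewrite -[_ *+ _]mulr_natl.
(* The terms [H] add up to [sqdist u mu], which the doubled left side absorbs. *)
by rewrite ler_pdivlMr// => h; lra.
Qed.

End pieces.

(** * Tail of a linear form in the noise *)

Section gaussian_tail.
Context (R : realType) (d : measure_display) (T : measurableType d)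
  (P : probability T R) (n : nat) (sigma : R) (xi : 'I_n -> {RV P >-> R}).
Hypothesis sigma0 : 0 < sigma.
Hypothesis xiN : forall (i : 'I_n) (A : set R), measurable A ->
  distribution P (xi i) A = normal_prob 0 sigma A.
Hypothesis indep : forall A : 'I_n -> set R, (forall i, measurable (A i)) ->
  fine (P [set w | forall i, A i (xi i w)]) =
  \prod_(i < n) fine (P (xi i @^-1` A i)).

Lemma measurable_dotf (v : 'I_n -> R) :
  measurable_fun setT (fun w => dotf (fun i => xi i w) v).
Proof.
by apply: measurable_sum => i; exact: measurable_funM.
Qed.

Lemma gaussian_mgf (v : 'I_n -> R) (r : R) :
  (\int[P]_w (expR (r * dotf (fun i => xi i w) v))%:E =
   (expR (sigma ^+ 2 * r ^+ 2 / 2 * dotf v v))%:E)%E.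
Proof.
have E i := integral_expR_normal (r * v i) sigma0 (xiN i).
transitivity (\int[P]_w (\prod_(i < n) expR (r * v i * xi i w))%:E)%E.
  apply: eq_integral => w _; rewrite -expR_sum /dotf mulr_sumr; congr (expR _)%:E.
  by apply: eq_bigr => i _; ring.
rewrite (@integral_prod_indep _ _ _ P n xi (fun i x => expR (r * v i * x)))//=.
- under eq_bigr do rewrite E /=.
  rewrite -expR_sum /dotf mulr_sumr; congr (expR _)%:E.
  by apply: eq_bigr => i _; field.
- by move=> i; apply: measurableT_comp => //; exact: measurable_funM.
- by move=> i; rewrite E.
Qed.

Lemma gaussian_tail (v : 'I_n -> R) (a : R) : dotf v v <= 1 -> 0 < a ->
  (P [set w | (a <= dotf (fun i => xi i w) v)%R] <=
   (expR (- (a ^+ 2 / (2 * sigma ^+ 2))))%:E)%E.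
Proof.
move=> v1 a0.
pose X : {RV P >-> R} := HB.pack (fun w => dotf (fun i => xi i w) v)
  (isMeasurableFun.Build _ _ _ _ _ (measurable_dotf v)).
(* The Chernoff parameter [r = a / sigma^2] minimizes [sigma^2 r^2 / 2 - r a]. *)
have r0 : 0 < a / sigma ^+ 2 by rewrite divr_gt0// exprn_gt0.
apply: le_trans (chernoff X a r0) _.
rewrite /mmt_gen_fun unlock /=.
under eq_integral do rewrite /= mulrC.
rewrite gaussian_mgf -EFinM lee_fin -expRD ler_expR.
have -> : - (a ^+ 2 / (2 * sigma ^+ 2)) =
  sigma ^+ 2 * (a / sigma ^+ 2) ^+ 2 / 2 * 1 - a / sigma ^+ 2 * a.
  by field; exact: lt0r_neq0.
rewrite lerD2r ler_wpM2l// divr_ge0// mulr_ge0 ?sqr_ge0//.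
Qed.

End gaussian_tail.

(** * The union bound and its numerical constants *)

Lemma measure_bigsetU_le (R : realType) (d : measure_display)
  (T : measurableType d) (m : {measure set T -> \bar R}) (I : Type) (r : seq I)
  (B : I -> set T) : (forall i, measurable (B i)) ->
  (m (\big[setU/set0]_(i <- r) B i) <= \sum_(i <- r) m (B i))%E.
Proof.
move=> mB; elim: r => [|i r IH]; first by rewrite !big_nil measure0.
rewrite !big_cons; apply: (le_trans (measureU2 _ _ _)) => //.
  exact: bigsetU_measurable.
exact: leeD2l.
Qed.

(** The factor counts pairs of endpoints, three frame vectors and two signs. Bounding 6 by [expR 3],
    the claim becomes [3 - 10/3 + (2 - 20/3) ln n + (5/3) ln alpha <= ln alpha], where [ln n >= 0]
    and [ln alpha <= 0]. *)
Lemma union_bound_estimate (R : realType) (n : nat) (alpha : R) :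
  (0 < n)%N -> 0 < alpha < 1 ->
  (n * n * 3 * 2)%:R *
    expR (- ((20 + 40 * ln (n%:R) + 10 * ln (alpha^-1)) / 6)) <= alpha.
Proof.
move=> n0 /andP[a0 a1].
have nR : 0 < n%:R :> R by rewrite ltr0n.
have l0 : 0 <= ln (n%:R : R) by rewrite ln_ge0// ler1n.
have la : ln alpha <= 0 by rewrite ln_le0// ltW.
have e1 : 2 <= expR 1 :> R by have := expR_ge1Dx (1 : R); lra.
have e3 : 6 <= expR 3 :> R.
  have -> : 3 = 1 + 1 + 1 :> R by lra.
  by rewrite !expRD; nra.
rewrite lnV ?posrE//.
have <- : expR (ln (n%:R)) * expR (ln (n%:R)) * 6 = (n * n * 3 * 2)%:R :> R.
  by rewrite lnK ?posrE// !natrM; ring.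
rewrite -{2}(lnK (_ : alpha \is Num.pos)) ?posrE//.
apply: (@le_trans _ _ (expR (ln n%:R) * expR (ln n%:R) * expR 3 *
  expR (- ((20 + 40 * ln n%:R + 10 * - ln alpha) / 6)))).
  by rewrite ler_wpM2r ?expR_ge0// ler_wpM2l// mulr_ge0 ?expR_ge0.
by rewrite -!expRD ler_expR; lra.
Qed.

(** * The good event and the confidence bound *)

Theorem mainTheorem7 (R : realType) (d : measure_display) (T : measurableType d)
  (P : probability T R) (n : nat) (sigma alpha : R) (mu : 'I_n -> R)
  (xi : 'I_n -> {RV P >-> R}) :
  (0 < n)%N -> 0 < sigma -> 0 < alpha < 1 -> convex_seq mu ->
  (* each noise coordinate is N(0, sigma^2) *)
  (forall (i : 'I_n) (A : set R), measurable A ->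
     distribution P (xi i) A = normal_prob 0 sigma A) ->
  (* the coordinates are mutually independent *)
  (forall A : 'I_n -> set R, (forall i, measurable (A i)) ->
     fine (P [set w | forall i, A i (xi i w)]) =
     \prod_(i < n) fine (P (xi i @^-1` A i))) ->
  let y := fun w (i : 'I_n) => mu i + xi i w in
  let muhat := fun w => proj_convex (y w) in
  exists2 F : set T, measurable F /\
      F `<=` [set w | n%:R^-1 * \sum_(i < n) (muhat w i - mu i) ^+ 2
                        <= rhat_cup sigma alpha (muhat w)] &
    ((1 - alpha)%:E <= P F)%E.
Proof.
move=> n0 s0 a01 cmu xiN indep y muhat.
have /choice[f fP] : forall se : 'I_n * 'I_n, exists e : nat -> 'I_n -> R,
    (forall j, dotf (e j) (e j) <= 1) /\
    forall (c : nat -> R) (x h : 'I_n -> R),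
    h = (fun i => \sum_(j < 3) c j * piece_gen mu se.1 se.2 j i) ->
    dotf x h ^+ 2 <= dotf h h * \sum_(j < 3) dotf x (e j) ^+ 2.
  by move=> se; exact: span_frame.
pose L : R := 20 + 40 * ln n%:R + 10 * ln alpha^-1.
have L0 : 0 < L.
  have : 0 <= ln (n%:R : R) by rewrite ln_ge0// ler1n.
  have : 0 <= ln alpha^-1.
    by case/andP: a01 => a0 a1; rewrite ln_ge0// invf_ge1// ltW.
  by rewrite /L; lra.
(* Each piece costs [3 t], one [t] per frame vector, so this choice makes the cost [sigma^2 L]. *)
pose t := sigma ^+ 2 * L / 3.
have t0 : 0 < t by rewrite divr_gt0// mulr_gt0// exprn_gt0.
pose a := Num.sqrt t.
have a0 : 0 < a by rewrite sqrtr_gt0.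
have a2 : a ^+ 2 = t by rewrite sqr_sqrtr// ltW.
(* The boolean is a sign: a two-sided bound on an inner product becomes two one-sided tails. *)
pose v (k : 'I_n * 'I_n * 'I_3 * bool) (i : 'I_n) : R := (-1) ^+ k.2 * f k.1.1 k.1.2 i.
pose B k := [set w | a <= dotf (fun i => xi i w) (v k)].
have v1 k : dotf (v k) (v k) <= 1.
  rewrite dotfZl dotfC dotfZl mulrA -expr2 sqrr_sign mul1r.
  exact: (fP k.1.1).1.
have mB k : measurable (B k).
  have := measurable_dotf xi (v k) measurableT (measurable_itv `[a, +oo[).
  rewrite setTI; congr measurable; apply/seteqP; split => w /=;
    by rewrite in_itv /= andbT.
pose U := \big[setU/set0]_k B k.
have mU : measurable U by apply: bigsetU_measurable.
have PU : (P U <= alpha%:E)%E.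
  apply: (le_trans (measure_bigsetU_le P _ mB)).
  apply: (@le_trans _ _ (\sum_(k : 'I_n * 'I_n * 'I_3 * bool)
      (expR (- (L / 6)))%:E)%E).
    apply: lee_sum => k _.
    have -> : L / 6 = a ^+ 2 / (2 * sigma ^+ 2).
      by rewrite a2 /t; field; exact: lt0r_neq0.
    exact: gaussian_tail.
  rewrite sumEFin sumr_const lee_fin -[_ *+ _]mulr_natl !card_prod !card_ord card_bool.
  exact: union_bound_estimate.
exists (~` U); last first.
  rewrite probability_setC// EFinB; exact: leeB.
split => [|w nU]; first exact: measurableC.
(* Outside [U] the inner product and its opposite are both below [a], so its square is at most
   [a^2 = t]. *)
have good s e (j : 'I_3) : dotf (fun i => xi i w) (f (s, e) j) ^+ 2 <= t.
  have out b : dotf (fun i => xi i w) (v (s, e, j, b)) < a.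
    rewrite ltNge; apply/negP => wB; apply: nU.
    by rewrite /U (bigD1 (s, e, j, b))//=; left.
  have vE b : dotf (fun i => xi i w) (v (s, e, j, b)) =
      (-1) ^+ b * dotf (fun i => xi i w) (f (s, e) j).
    by rewrite dotfC dotfZl dotfC.
  have := out true; have := out false; rewrite !vE expr0 expr1 mul1r mulN1r.
  move=> h1 h2; rewrite -a2; nra.
have := @sqdist_le_qpieces _ _ _ _ _ _ (fun s e => f (s, e)) (ltW t0) cmu
  (proj_convexP (y w)) (fun s e => (fP (s, e)).2) good.
rewrite /= -/(muhat w) /rhat_cup -/L -/(sqdist (muhat w) mu) => h.
have nR : 0 < n%:R :> R by rewrite ltr0n.
rewrite mulrC ler_pdivrMr// divfK ?gt_eqF//.
by apply: le_trans h _; rewrite /t le_eqVlt; apply/orP; left; apply/eqP; field.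
Qed.
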